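(* Let $d\ge 1$ be an integer. A pair $(T,S)$ of functions $T,S:\mathcal{M}(\mathbb{R}^d)\times\mathcal{M}(\mathbb{R}^d)\times\mathbb{R}^d\to\mathbb{R}^d$ is a frugal resolvent-splitting without lifting for the problem class (2op-$\mathbb{R}^d$) if and only if it is equivalent to a pair $(\hat T,\hat S)$ of the following form: there exist real numbers $\alpha,\beta>0$, $\theta\neq 0$ and $\eta\in\mathbb{R}$ such that, for all $A,B\in\mathcal{M}(\mathbb{R}^d)$ and $z\in\mathbb{R}^d$, $$x_1=J_{\alpha A}(z),\qquad x_2=J_{\beta B}\big((1+\beta/\alpha)x_1-(\beta/\alpha)z\big),$$ $$\hat T(A,B,z)=z+\theta(x_2-x_1),\qquad \hat S(A,B,z)=\eta x_1+(1-\eta)x_2 .$$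
   Context: $\mathcal{M}(\mathbb{R}^d)$ is the set of all maximal monotone (set-valued) operators on $\mathbb{R}^d$ (with the Euclidean inner product). For $A\in\mathcal{M}(\mathbb{R}^d)$ and $\alpha>0$, $J_{\alpha A}=(I+\alpha A)^{-1}:\mathbb{R}^d\to\mathbb{R}^d$ is the resolvent. Problem class (2op-$\mathbb{R}^d$): all problems of finding $x\in\mathbb{R}^d$ with $0\in(A+B)x$, where $A,B\in\mathcal{M}(\mathbb{R}^d)$. Fixed-point encoding: a pair $(T,S)$ with $T,S:\mathcal{M}(\mathbb{R}^d)\times\mathcal{M}(\mathbb{R}^d)\times\mathbb{R}^d\to\mathbb{R}^d$ is a fixed-point encoding for (2op-$\mathbb{R}^d$) if for all $A,B\in\mathcal{M}(\mathbb{R}^d)$ and all $x^\star\in\mathbb{R}^d$: there exists $z^\star\in\mathbb{R}^d$ with $T(A,B,z^\star)=z^\star$ and $S(A,B,z^\star)=x^\star$ if and only if $0\in(A+B)(x^\star)$. The class $\mathcal{F}$: consider maps $\mathcal{M}(\mathbb{R}^d)\times\mathcal{M}(\mathbb{R}^d)\times\mathbb{R}^d\to\mathbb{R}^d$. Let $I(A,B,z)=z$, $J_{\alpha,1}(A,B,z)=J_{\alpha A}(z)$, $J_{\beta,2}(A,B,z)=J_{\beta B}(z)$. Composition is $(F\circ G)(A,B,z)=F(A,B,G(A,B,z))$. Let $\mathcal{F}_0=\{I\}\cup\{J_{\alpha,1}:\alpha>0\}\cup\{J_{\beta,2}:\beta>0\}$, and recursively $\mathcal{F}_{i+1}=\{F+G: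 F,G\in\mathcal{F}_i\}\cup\{F\circ G:F,G\in\mathcal{F}_i\}\cup\{\gamma F:F\in\mathcal{F}_i,\gamma\in\mathbb{R}\}$, and $\mathcal{F}=\bigcup_{i\ge0}\mathcal{F}_i$. $(T,S)$ is a resolvent-splitting without lifting for (2op-$\mathbb{R}^d$) if it is a fixed-point encoding for (2op-$\mathbb{R}^d$) and $T,S\in\mathcal{F}$. Such $(T,S)$ is frugal if, for some fixed $\alpha,\beta>0$, there is a finite step-by-step (serial) evaluation procedure (the same for all $A,B,z$) which starts from the input $z$, where each step is a scalar multiplication (by a fixed real), a vector addition, or a resolvent evaluation applied to previously available vectors, exactly one step evaluates $J_{\alpha A}$, exactly one step evaluates $J_{\beta B}$, and both $T(A,B,z)$ and $S(A,B,z)$ are output at the end. Equivalence: two resolvent-splittings without lifting are equivalent if one can be obtained from the other through scaling with a nonzero scalar and/or swapping the roles of $A$ and $B$. Scaling by $a\ne0$ replaces $(T,S)$ by the pair $(A,B,z)\mapsto aT(A,B,a^{-1}z)$, $(A,B,z)\mapsto S(A,B,a^{-1}z)$. Swapping replaces $(T,S)$ by the pair $(A,B,z)\mapsto T(B,A,z)$, $(A,B,z)\mapsto S(B,A,z)$. *)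

(* Defs.v *)
From HB Require Import structures.
From mathcomp Require Import all_boot all_order all_algebra.
From mathcomp Require Import all_classical all_reals.

Set Implicit Arguments.
Unset Strict Implicit.
Unset Printing Implicit Defensive.

Import Order.TTheory GRing.Theory Num.Theory.
Local Open Scope classical_set_scope.
Local Open Scope ring_scope.

Section SetValuedOperators.
Variables (R : realType) (d : nat).
Local Notation vec := 'rV[R]_d.

Definition dot (x y : vec) : R := \sum_i x 0 i * y 0 i.

Definition operator := vec -> set vec.

Implicit Types A B : operator.

Definition op_id : operator := fun x => [set x].
Definition op_add A B : operator := fun x => [set u + v | u in A x & v in B x].
Definition op_scale (a : R) A : operator := fun x => [set a *: u | u in A x].
Definition op_inv A : operator := fun y => [set x | A x y].

Definition monotone A : Prop :=
  forall x y u v, A x u -> A y v -> 0 <= dot (x - y) (u - v).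

Definition maximal_monotone A : Prop :=
  monotone A /\
  forall B, monotone B -> (forall x, A x `<=` B x) -> B = A.

Record maxmon : Type := MaxMon {
  maxmon_op :> operator;
  maxmonP : maximal_monotone maxmon_op }.

(* For A maximal monotone and 0 < a, the set-valued inverse (I + a A)^-1 is
   everywhere defined and single-valued by Minty's theorem, so [xget] selects
   its only value and the default 0 is never used. *)
Definition resolvent (a : R) A (z : vec) : vec :=
  xget 0 (op_inv (op_add op_id (op_scale a A)) z).

End SetValuedOperators.

Section Splittings.
Variables (R : realType) (d : nat).
Local Notation vec := 'rV[R]_d.
Local Notation M := (maxmon R d).

Definition opmap := M -> M -> vec -> vec.

Implicit Types T S F G : opmap.

Definition fixed_point_encoding T S : Prop :=
  forall (A B : M) (x : vec),
    (exists z, T A B z = z /\ S A B z = x) <-> op_add A B x 0.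

Definition map_id : opmap := fun _ _ z => z.
Definition map_res1 (a : R) : opmap := fun A _ z => resolvent a A z.
Definition map_res2 (b : R) : opmap := fun _ B z => resolvent b B z.
Definition map_add F G : opmap := fun A B z => F A B z + G A B z.
Definition map_comp F G : opmap := fun A B z => F A B (G A B z).
Definition map_scale (c : R) F : opmap := fun A B z => c *: F A B z.

Fixpoint res_stage (i : nat) : set opmap :=
  if i is j.+1 then
    [set map_add F G | F in res_stage j & G in res_stage j] `|`
    [set map_comp F G | F in res_stage j & G in res_stage j] `|`
    [set map_scale c F | c in [set: R] & F in res_stage j]
  else
    [set map_id] `|` [set map_res1 a | a in [set a : R | 0 < a]] `|`
    [set map_res2 b | b in [set b : R | 0 < b]].

Definition res_class : set opmap := \bigcup_i res_stage i.

Definition splitting_without_lifting T S : Prop :=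
  [/\ fixed_point_encoding T S, res_class T & res_class S].

(* Operands are addresses in the list of available vectors: address 0 is the
   input z and address k.+1 is the result of the k-th step. *)
Inductive step : Type :=
  | ScaleStep of R & nat
  | AddStep of nat & nat
  | ResAStep of nat
  | ResBStep of nat.

Definition operands (s : step) : seq nat :=
  match s with
  | ScaleStep _ i => [:: i]
  | AddStep i j => [:: i; j]
  | ResAStep i => [:: i]
  | ResBStep i => [:: i]
  end.

Definition is_resA (s : step) : bool := if s is ResAStep _ then true else false.
Definition is_resB (s : step) : bool := if s is ResBStep _ then true else false.

(* [n] is the number of vectors available before the first step of [p]. *)
Fixpoint well_formed (n : nat) (p : seq step) : bool :=
  if p is s :: q then all (fun i => (i < n)%N) (operands s) && well_formed n.+1 q
  else true.

Definition step_value (alpha beta : R) (A B : M) (vs : seq vec) (s : step) : vec :=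
  match s with
  | ScaleStep c i => c *: nth 0 vs i
  | AddStep i j => nth 0 vs i + nth 0 vs j
  | ResAStep i => resolvent alpha A (nth 0 vs i)
  | ResBStep i => resolvent beta B (nth 0 vs i)
  end.

Definition run (alpha beta : R) (A B : M) (z : vec) (p : seq step) : seq vec :=
  foldl (fun vs s => rcons vs (step_value alpha beta A B vs s)) [:: z] p.

Definition frugal T S : Prop :=
  exists alpha beta : R, exists p : seq step, exists i j : nat,
    [/\ 0 < alpha, 0 < beta,
        [/\ well_formed 1 p, (i <= size p)%N & (j <= size p)%N],
        count is_resA p = 1%N /\ count is_resB p = 1%N &
        forall A B z,
          T A B z = nth 0 (run alpha beta A B z p) i /\
          S A B z = nth 0 (run alpha beta A B z p) j].

Definition frugal_splitting_without_lifting T S : Prop :=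
  splitting_without_lifting T S /\ frugal T S.

Definition scale_pair (a : R) (P : opmap * opmap) : opmap * opmap :=
  (fun A B z => a *: P.1 A B (a^-1 *: z), fun A B z => P.2 A B (a^-1 *: z)).

Definition swap_pair (P : opmap * opmap) : opmap * opmap :=
  (fun A B z => P.1 B A z, fun A B z => P.2 B A z).

(* Scalings compose, swapping is an involution and the two commute, so every
   succession of these operations is one scaling (by 1 when there is none)
   preceded by at most one swap; the relation is therefore symmetric. *)
Definition equivalent (P Q : opmap * opmap) : Prop :=
  exists2 a : R, a != 0 & P = scale_pair a Q \/ P = scale_pair a (swap_pair Q).

End Splittings.

(* Main.v *)
Require Import Defs.
From mathcomp Require Import all_boot all_order all_algebra.
From mathcomp Require Import all_classical all_reals.
From mathcomp Require Import ring lra.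

(** Write x1 and x2 for the two resolvent values met along an evaluation.

    A procedure that evaluates each resolvent once can only form linear
    combinations in between, so, if A comes first, there are real coefficients,
    the same for all A, B and z, with
      x1 = J_(alpha A) (a z),   x2 = J_(beta B) (b z + c x1),
      T = t0 z + t1 x1 + t2 x2,   S = s0 z + s1 x1 + s2 x2
    ([program_shape]); if B comes first, the same holds after a swap.

    Testing the encoding property on two very simple kinds of operators pins
    all these coefficients down.  The normal cone of a point p has the constant
    resolvent p, whatever the input.  For two distinct points A + B has no
    zero, hence T has no fixed point, although x1 and x2 are then arbitrary
    distinct constants: this forces t0 = 1 and t2 <> 0.  For twice the same
    point p the only zero is p: a fixed point exists, so t1 + t2 = 0; then
    every z is a fixed point and S must send it to p, so s0 = 0 and
    s1 + s2 = 1.  Now fixed points are the z with x1 = x2 = x.  For the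
    constant operators u and - u every x is a zero, so for all x and u some z
    satisfies a z = x + alpha u and b z = (1 - c) x - beta u; this gives
    a <> 0, b = - (beta / alpha) a and c = 1 + beta / alpha
    ([encoding_input_coeffs]).  The pair obtained is the announced one scaled
    by 1 / a.

    Conversely a fixed point of the announced T satisfies x1 = x2 = x, and then
    (z - x) / alpha lies in A x while the input x + (beta / alpha) (x - z) of
    the second resolvent puts the opposite vector (x - z) / alpha in B x.
    Reading x1 = J_(alpha A) z as a membership in A requires the resolvent to
    be defined everywhere, which is Minty's theorem ([resolvent_mem]).  It is
    obtained here by minimising a strongly convex function over the convex hull
    of the lifted graph of A, the points (x, u, <x, u>); suprema of sets of
    reals suffice to find the minimiser ([strongly_convex_minimum]). *)

Set Implicit Arguments.
Unset Strict Implicit.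
Unset Printing Implicit Defensive.

Import Order.TTheory GRing.Theory Num.Theory.
Local Open Scope ring_scope.

(** * The Euclidean inner product *)

Section InnerProduct.
Context {R : realType} {d : nat}.
Implicit Types (x y z : 'rV[R]_d) (a : R).

Lemma dotC x y : dot x y = dot y x.
Proof. by apply: eq_bigr => i _; rewrite mulrC. Qed.

Lemma dotDl x y z : dot (x + y) z = dot x z + dot y z.
Proof. by rewrite /dot -big_split; apply: eq_bigr => i _; rewrite mxE mulrDl. Qed.

Lemma dotZl a x y : dot (a *: x) y = a * dot x y.
Proof. by rewrite /dot mulr_sumr; apply: eq_bigr => i _; rewrite mxE mulrA. Qed.

Lemma dotDr x y z : dot x (y + z) = dot x y + dot x z.
Proof. by rewrite !(dotC x) dotDl. Qed.

Lemma dotZr a x y : dot x (a *: y) = a * dot x y.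
Proof. by rewrite !(dotC x) dotZl. Qed.

Lemma dotNl x y : dot (- x) y = - dot x y.
Proof. by rewrite -scaleN1r dotZl mulN1r. Qed.

Lemma dotNr x y : dot x (- y) = - dot x y.
Proof. by rewrite !(dotC x) dotNl. Qed.

Definition dotE := (dotDl, dotDr, dotNl, dotNr, dotZl, dotZr).

Lemma dot_ge0 x : 0 <= dot x x.
Proof. by apply: sumr_ge0 => i _; rewrite -expr2 sqr_ge0. Qed.

Lemma sqr_coord_le x (i : 'I_d) : x 0 i ^+ 2 <= dot x x.
Proof.
rewrite /dot (bigD1 i) //= -expr2 lerDl.
by apply: sumr_ge0 => j _; rewrite -expr2 sqr_ge0.
Qed.

Lemma dot_eq0 x : dot x x <= 0 -> x = 0.
Proof.
move=> x0; apply/rowP => i; rewrite mxE; apply/eqP.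
have := le_trans (sqr_coord_le x i) x0.
by rewrite -sqrf_eq0 eq_le sqr_ge0 andbT.
Qed.

End InnerProduct.

(** * Minimisers of strongly convex functions *)

Section StronglyConvexMinimum.
Context {R : realType} {d : nat}.
(** [E y f] reads: the value [f] is reached at the point [y].  A relation is
    used, not a function on a set of points, because several points of the
    lifted graph below may share the same [y]. *)
Variable E : 'rV[R]_d -> R -> Prop.
Hypothesis E_nonempty : exists y f, E y f.
Hypothesis E_ge0 : forall y f, E y f -> 0 <= f.
Hypothesis E_mix : forall (t : R) y1 f1 y2 f2, 0 <= t <= 1 -> E y1 f1 -> E y2 f2 ->
  E (t *: y1 + (1 - t) *: y2)
    (t * f1 + (1 - t) * f2 - t * (1 - t) * dot (y1 - y2) (y1 - y2)).

Let values : set R := fun f => exists y, E y f.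
Let m := inf values.

Let has_inf_values : has_inf values.
Proof.
split; first by case: E_nonempty => y [f Ef]; exists f, y.
by exists 0 => f [y /E_ge0].
Qed.

Let m_le y f : E y f -> m <= f.
Proof. by move=> Ef; apply: ge_inf; [case: has_inf_values | exists y]. Qed.

Let m_ge0 : 0 <= m.
Proof.
apply: lb_le_inf; first by case: has_inf_values.
by move=> f [y /E_ge0].
Qed.

Let near_minimal (e : R) : 0 < e -> exists y f, E y f /\ f <= m + e.
Proof.
move=> e0; have [f [y Ef] lt_f] := inf_adherent e0 has_inf_values.
by exists y, f; split=> //; apply: ltW.
Qed.

(** Strong convexity at a midpoint gives
    [dot (y1 - y2) (y1 - y2) <= 2 * (f1 - m) + 2 * (f2 - m)], so the
    intervals of this radius around a given coordinate of the points of [E] meet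
    pairwise. *)
Let radius (f : R) : R := Num.sqrt (2 * (f - m)).

Let coord_dist y1 f1 y2 f2 i : E y1 f1 -> E y2 f2 ->
  y1 0 i - radius f1 <= y2 0 i + radius f2.
Proof.
move=> E1 E2.
have half : 0 <= (2^-1 : R) <= 1 by lra.
have := m_le (E_mix half E1 E2); have := m_le E1; have := m_le E2.
have := sqr_coord_le (y1 - y2) i; rewrite !mxE => le_i le2 le1 lemix.
have r1 : 0 <= radius f1 by apply: sqrtr_ge0.
have r2 : 0 <= radius f2 by apply: sqrtr_ge0.
have s1 : radius f1 ^+ 2 = 2 * (f1 - m) by rewrite sqr_sqrtr //; lra.
have s2 : radius f2 ^+ 2 = 2 * (f2 - m) by rewrite sqr_sqrtr //; lra.
rewrite lerBlDr -addrA -lerBlDl.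
apply: le_trans (ler_norm _) _.
rewrite -(@ler_pXn2r _ 2) ?nnegrE ?addr_ge0 // real_normK ?num_real //.
have := mulr_ge0 r1 r2; nra.
Qed.

(** The point [y0] is the limit of the almost minimal points.  Each of its
    coordinates is a supremum of lower ends of the pairwise meeting intervals
    [y 0 i - radius f, y 0 i + radius f], hence lies in all of them.  This puts
    [y0] close to every almost minimal point; the sharp inequality follows by
    moving from such a point a little towards [y] and comparing with the
    infimum, which is nonnegative. *)
Lemma strongly_convex_minimum :
  exists y0, forall y f, E y f -> dot (y - y0) (y - y0) <= f.
Proof.
pose low i : set R := fun r => exists y f, E y f /\ r = y 0 i - radius f.
pose y0 : 'rV[R]_d := \row_i sup (low i).
have close y f i : E y f -> (y 0 i - y0 0 i) ^+ 2 <= 2 * (f - m).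
  move=> Ef; rewrite mxE.
  have up : sup (low i) <= y 0 i + radius f.
    apply: ge_sup; first by exists (y 0 i - radius f), y, f.
    by move=> _ [y1 [f1 [E1 ->]]]; apply: coord_dist.
  have dn : y 0 i - radius f <= sup (low i).
    apply: ub_le_sup; last by exists y, f.
    exists (y 0 i + radius f) => _ [y1 [f1 [E1 ->]]]; exact: coord_dist.
  have s : radius f ^+ 2 = 2 * (f - m).
    by rewrite sqr_sqrtr // mulr_ge0 // subr_ge0 (m_le Ef).
  rewrite -s -real_normK ?num_real // ler_pXn2r ?nnegrE ?sqrtr_ge0 //.
  rewrite ler_norml; lra.
have closed y f : E y f -> dot (y - y0) (y - y0) <= d%:R * (2 * (f - m)).
  move=> Ef; rewrite /dot -[d in d%:R]card_ord mulr_natl -sumr_const.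
  by apply: ler_sum => i _; rewrite -expr2 [(y - y0) 0 i]mxE [(- y0) 0 i]mxE close.
exists y0 => y' f' E'.
have f'0 := E_ge0 E'.
(* Any constant that dominates the first-order terms in [t] does. *)
pose C : R := 4 * f' + 3 + 4 * d%:R.
have d0 : 0 <= (d%:R : R) by [].
have C0 : 0 < C by rewrite /C; lra.
suff bound (t : R) : 0 < t <= 1/2 -> dot (y' - y0) (y' - y0) <= f' + C * t.
  apply/ler_addgt0Pr => e e0.
  pose t := Num.min (1/2) (e / C).
  have t0 : 0 < t by rewrite lt_min; apply/andP; split; [lra | exact: divr_gt0].
  have th : t <= 1/2 by rewrite /t ge_min lexx.
  apply: le_trans (bound t _) _; first by rewrite t0.
  rewrite lerD2l mulrC -ler_pdivlMr // /t ge_min lexx orbT //.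
move=> /andP[t0 th].
have t20 : 0 < t ^+ 2 by rewrite exprn_gt0.
have [y [f [Ef fle]]] := near_minimal t20.
have t01 : 0 <= t <= 1 by lra.
have mix := m_le (E_mix t01 E' Ef).
have mf := m_le Ef.
have cl := closed y f Ef.
set D := dot (y' - y) (y' - y) in mix.
have D0 : 0 <= D by apply: dot_ge0.
set X := dot (y' - y0) (y' - y0).
set Y := dot (y - y0) (y - y0) in cl.
(* Young's inequality with weight [t], multiplied by [t]. *)
have young : t * X <= t * (1 + t) * D + (1 + t) * Y.
  have := dot_ge0 (t *: (y' - y) - (y - y0)).
  rewrite /X /Y /D; have -> : y' - y0 = (y' - y) + (y - y0) by rewrite addrA subrK.
  move: (y' - y) (y - y0) => a b.
  rewrite !dotE (dotC b a); nra.
have D_le : (1 - t) * D <= f' + t.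
  rewrite -(ler_pM2l t0); have := mulr_ge0 (ltW t0) m_ge0; nra.
have X_le : X <= (1 + t) * D + (1 + t) * (2 * d%:R * t).
  rewrite -(ler_pM2l t0); apply: le_trans young _.
  have : (1 + t) * Y <= (1 + t) * (d%:R * (2 * t ^+ 2)).
    rewrite ler_pM2l; last by lra.
    apply: le_trans cl _; rewrite ler_wpM2l //; lra.
  nra.
have : (1 + t) * D <= (1 + 4 * t) * (f' + t).
  apply: le_trans (_ : _ <= (1 + 4 * t) * ((1 - t) * D)) _.
    rewrite mulrA ler_wpM2r //; nra.
  rewrite ler_pM2l //; lra.
have : (1 + t) * (2 * d%:R * t) <= 4 * d%:R * t.
  rewrite -subr_ge0; have -> : 4 * d%:R * t - (1 + t) * (2 * d%:R * t) =
    2 * d%:R * t * (1 - t) by ring.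
  rewrite !mulr_ge0 //; lra.
rewrite /C; nra.
Qed.

End StronglyConvexMinimum.

(** * Minty's theorem *)

Section Minty.
Context {R : realType} {d : nat}.
Implicit Types (x y u v p : 'rV[R]_d) (G : operator R d).

(** The third coordinate linearises the form [dot x u] along convex
    combinations of points of the graph. *)
Inductive graph_hull G : 'rV[R]_d -> 'rV[R]_d -> R -> Prop :=
  | hull_point x u : G x u -> graph_hull G x u (dot x u)
  | hull_mix (t : R) x1 u1 c1 x2 u2 c2 : 0 <= t <= 1 ->
      graph_hull G x1 u1 c1 -> graph_hull G x2 u2 c2 ->
      graph_hull G (t *: x1 + (1 - t) *: x2) (t *: u1 + (1 - t) *: u2)
        (t * c1 + (1 - t) * c2).

(** For two points of the graph this is monotonicity, and the right-hand side is
    affine in each triple separately, so it passes to the hull one argument at a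
    time.  Taken twice at the same triple it says [dot x u <= c]. *)
Lemma graph_hull_pairing G x1 u1 c1 x2 u2 c2 : monotone G ->
  graph_hull G x1 u1 c1 -> graph_hull G x2 u2 c2 ->
  0 <= c1 + c2 - dot x1 u2 - dot x2 u1.
Proof.
move=> monG h1 h2.
elim: h1 => {x1 u1 c1} [x1 u1 G1|t x u c y v e /andP[t0 t1] _ IH1 _ IH2]; last first.
  set w := (X in 0 <= X).
  have -> : w = t * (c + c2 - dot x u2 - dot x2 u) +
                (1 - t) * (e + c2 - dot y u2 - dot x2 v).
    by rewrite /w !dotE; ring.
  by rewrite addr_ge0 // mulr_ge0 // subr_ge0.
elim: h2 => {x2 u2 c2} [x2 u2 G2|t x u c y v e /andP[t0 t1] _ IH1 _ IH2]; last first.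
  set w := (X in 0 <= X).
  have -> : w = t * (dot x1 u1 + c - dot x1 u - dot x u1) +
                (1 - t) * (dot x1 u1 + e - dot x1 v - dot y u1).
    by rewrite /w !dotE; ring.
  by rewrite addr_ge0 // mulr_ge0 // subr_ge0.
have := monG _ _ _ _ G1 G2; rewrite !dotE; lra.
Qed.

(** For a point [(x, u)] of the graph, expanding squares shows that the required
    inequality is [dot (y' - y) (y' - y) <= f], where [y' = (x - u + p) / 2] and
    [f = dot x u - dot x p + dot y' y'].  On the hull [f], with [c] in place of
    [dot x u], is strongly convex, and it is bounded below by the square of
    [(x + u - p) / 2]; its minimiser is the [y] looked for. *)
Lemma monotone_extension G p : monotone G ->
  exists y, forall x u, G x u -> 0 <= dot (x - y) (u - (p - y)).
Proof.
move=> monG.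
have [[x0 [u0 G0]]|Gempty] := pselect (exists x u, G x u); last first.
  by exists 0 => x u Gxu; case: Gempty; exists x, u.
pose center x u := 2^-1 *: (x - u + p).
pose E y f := exists x u c, [/\ graph_hull G x u c, y = center x u &
  f = c - dot x p + dot y y].
have E0 y f : E y f -> 0 <= f.
  move=> [x [u [c [h -> ->]]]]; have := graph_hull_pairing monG h h.
  have := dot_ge0 (x + (u - p)).
  rewrite /center !dotE (dotC u x) (dotC p x) (dotC p u); lra.
have Emix (t : R) y1 f1 y2 f2 : 0 <= t <= 1 -> E y1 f1 -> E y2 f2 ->
    E (t *: y1 + (1 - t) *: y2)
      (t * f1 + (1 - t) * f2 - t * (1 - t) * dot (y1 - y2) (y1 - y2)).
  move=> t01 [x1 [u1 [c1 [h1 -> ->]]]] [x2 [u2 [c2 [h2 -> ->]]]].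
  exists (t *: x1 + (1 - t) *: x2), (t *: u1 + (1 - t) *: u2),
    (t * c1 + (1 - t) * c2); split; first exact: hull_mix.
    by apply/rowP => i; rewrite /center !mxE; ring.
  by move: (center x1 u1) (center x2 u2) => a b; rewrite !dotE (dotC b a); ring.
have [|y y_le] := strongly_convex_minimum _ E0 Emix.
  by eexists; eexists; exists x0, u0, (dot x0 u0); split=> //; exact: hull_point.
exists y => x u Gxu.
have /y_le : E (center x u) (dot x u - dot x p + dot (center x u) (center x u)).
  by exists x, u, (dot x u); split=> //; exact: hull_point.
rewrite /center !dotE.
rewrite (dotC y x) (dotC y u) (dotC y p) (dotC u x) (dotC p x) (dotC p u); lra.
Qed.

Lemma resolvent_eq (a : R) (A : operator R d) x u : monotone A -> 0 < a -> A x u ->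
  resolvent a A (x + a *: u) = x.
Proof.
move=> monA a0 Axu; rewrite /resolvent.
set Z := op_inv _ _; have Zx : Z x.
  by exists x => //; exists (a *: u) => //; exists u.
case: xgetP => [y _ [_ -> [_ [v Ayv <-]] eq_yv]|/(_ x)//].
apply/subr0_eq/dot_eq0.
have eq_yx : y - x = a *: (u - v).
  by apply/rowP => i; move/rowP/(_ i): eq_yv; rewrite !mxE; lra.
have := monA _ _ _ _ Ayv Axu.
have -> : v - u = - (a^-1 *: (y - x)).
  by rewrite eq_yx scalerA mulVf ?gt_eqF // scale1r opprB.
by rewrite dotNr dotZr oppr_ge0 pmulr_rle0 // invr_gt0.
Qed.

(** Scaling the values of [A] by [a], the extension lemma yields a pair [(y, v)]
    with [y + a v = z] that is monotonically related to the whole graph of [A];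
    by maximality it already belongs to that graph. *)
Lemma resolvent_mem (a : R) (A : maxmon R d) z : 0 < a ->
  maxmon_op A (resolvent a A z) (a^-1 *: (z - resolvent a A z)).
Proof.
move=> a0; have [monA maxA] := maxmonP A.
pose G : operator R d := fun x u => maxmon_op A x (a^-1 *: u).
have a0' : a != 0 by rewrite gt_eqF.
have monG : monotone G.
  move=> x y u v Gu Gv; have := monA _ _ _ _ Gu Gv.
  by rewrite -scalerBr dotZr pmulr_rge0 // invr_gt0.
have [y y_ext] := monotone_extension z monG.
pose v := a^-1 *: (z - y).
have ext x u : maxmon_op A x u -> 0 <= dot (x - y) (u - v).
  move=> Axu; have := y_ext x (a *: u).
  rewrite /G scalerA mulVf // scale1r => /(_ Axu).
  have -> : a *: u - (z - y) = a *: (u - v).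
    by rewrite scalerBr /v scalerA mulfV // scale1r.
  by rewrite dotZr pmulr_rge0.
pose B : operator R d := fun x u => maxmon_op A x u \/ x = y /\ u = v.
have BA : B = maxmon_op A.
  apply: maxA => [|x u]; last by left.
  move=> x1 x2 u1 u2 [A1|[-> ->]] [A2|[-> ->]].
  - exact: monA.
  - exact: ext.
  - by rewrite -(opprB x2) -(opprB u2) dotNl dotNr opprK; exact: ext.
  - by rewrite !subrr dot_ge0.
have Ayv : maxmon_op A y v by rewrite -[X in X y v]BA; right.
suff -> : resolvent a A z = y by [].
rewrite -(resolvent_eq monA a0 Ayv) /v scalerA mulfV // scale1r.
by rewrite addrC subrK.
Qed.

End Minty.

(** * Test operators with explicit resolvents *)

Section TestOperators.
Context {R : realType} {d : nat}.
Implicit Types (x y u v p z : 'rV[R]_d).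

Definition const_op u : operator R d := fun _ => [set u]%classic.

Lemma const_op_maximal u : maximal_monotone (const_op u).
Proof.
split=> [x y _ _ -> ->|B monB AB]; first by rewrite subrr -(scale0r 0) dotZr mul0r.
apply/funext => y; apply/seteqP; split=> [v Bv|]; last exact: AB.
apply/subr0_eq/dot_eq0; rewrite -oppr_ge0 -dotNr opprB.
by have := monB _ _ _ _ (AB (y + (v - u)) u erefl) Bv; rewrite addrAC subrr add0r.
Qed.

(** The normal cone of the set [{p}]. *)
Definition point_op p : operator R d := fun x => [set _ | x = p]%classic.

Lemma point_op_maximal p : maximal_monotone (point_op p).
Proof.
split=> [x y u v -> ->|B monB AB]; first by rewrite subrr -(scale0r 0) dotZl mul0r.
apply/funext => y; apply/seteqP; split=> [v Bv|]; last exact: AB.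
rewrite /point_op /=; apply/subr0_eq/dot_eq0; rewrite -oppr_ge0 -dotNl opprB.
by have := monB _ _ _ _ (AB p (v + (y - p)) erefl) Bv; rewrite addrAC subrr add0r.
Qed.

Definition const_maxmon u := MaxMon (const_op_maximal u).
Definition point_maxmon p := MaxMon (point_op_maximal p).

Lemma resolvent_const (a : R) u z : 0 < a -> resolvent a (const_maxmon u) z = z - a *: u.
Proof.
move=> a0; rewrite -{1}(subrK (a *: u) z).
by apply: resolvent_eq => //; case: (const_op_maximal u).
Qed.

Lemma resolvent_point (a : R) p z : 0 < a -> resolvent a (point_maxmon p) z = p.
Proof.
move=> a0; have -> : z = p + a *: (a^-1 *: (z - p)).
  by rewrite scalerA mulfV ?gt_eqF // scale1r addrC subrK.
by apply: resolvent_eq => //; case: (point_op_maximal p).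
Qed.

Lemma zero_const u x : op_add (const_maxmon u) (const_maxmon (- u)) x 0.
Proof. by exists u => //; exists (- u) => //; rewrite subrr. Qed.

Lemma zero_point p q x : op_add (point_maxmon p) (point_maxmon q) x 0 <-> x = p /\ x = q.
Proof.
split=> [[u xp [v xq _]]|[xp xq]]; first by [].
by exists 0 => //; exists 0; rewrite // addr0.
Qed.

End TestOperators.

(** * Rigidity of the coefficients *)

Section Rigidity.
Context {R : realType} {d : nat}.
Variables (T S : opmap R d) (alpha beta a b c t0 t1 t2 s0 s1 s2 : R).
Hypotheses (hd : (1 <= d)%N) (alpha0 : 0 < alpha) (beta0 : 0 < beta).
Hypothesis enc : fixed_point_encoding T S.
Hypothesis shape : forall (A B : maxmon R d) z,
  let x1 := resolvent alpha A (a *: z) in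
  let x2 := resolvent beta B (b *: z + c *: x1) in
  T A B z = t0 *: z + t1 *: x1 + t2 *: x2 /\
  S A B z = s0 *: z + s1 *: x1 + s2 *: x2.

Let e : 'rV[R]_d := const_mx 1.

Let scaler_e_inj (k l : R) : k *: e = l *: e -> k = l.
Proof. by move=> /rowP /(_ (Ordinal hd)); rewrite !mxE !mulr1. Qed.

Let T_point p q z : T (point_maxmon p) (point_maxmon q) z = t0 *: z + t1 *: p + t2 *: q.
Proof.
by have [-> _] := shape (point_maxmon p) (point_maxmon q) z; rewrite !resolvent_point.
Qed.

Let S_point p q z : S (point_maxmon p) (point_maxmon q) z = s0 *: z + s1 *: p + s2 *: q.
Proof.
by have [_ ->] := shape (point_maxmon p) (point_maxmon q) z; rewrite !resolvent_point.
Qed.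

(** The points [0] and [e] are distinct, so the sum of their normal cones has no
    zero. *)
Let no_fixed_point (z : 'rV[R]_d) : t0 *: z + t2 *: e <> z.
Proof.
move=> fix_z; have /zero_point[] : op_add (point_maxmon 0) (point_maxmon e)
    (S (point_maxmon 0) (point_maxmon e) z) 0.
  by apply/enc; exists z; rewrite T_point scaler0 addr0.
move=> -> e0; have /scaler_e_inj /eqP : 0 *: e = 1 *: e by rewrite scale0r scale1r.
by rewrite eq_sym oner_eq0.
Qed.

(** Otherwise the equation [t0 *: z + t2 *: e = z] could be solved for [z]. *)
Lemma encoding_T_input_coeff : t0 = 1.
Proof.
apply/eqP; apply/negPn/negP => t0n.
have k0 : 1 - t0 != 0 by rewrite subr_eq0 eq_sym.
apply: (@no_fixed_point (((1 - t0)^-1 * t2) *: e)).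
rewrite scalerA -scalerDl; congr (_ *: e); field; exact: k0.
Qed.

Lemma encoding_T_coeff_neq0 : t2 != 0.
Proof.
apply/eqP => t20; apply: (@no_fixed_point 0).
by rewrite t20 scaler0 scale0r addr0.
Qed.

Lemma encoding_T_opposite_coeffs : t1 = - t2.
Proof.
have [_ /(_ _)] := enc (point_maxmon e) (point_maxmon e) e.
case; first by apply/zero_point.
move=> z [+ _]; rewrite T_point encoding_T_input_coeff scale1r -addrA -scalerDl.
rewrite -[RHS]addr0 => /addrI; rewrite -(scale0r e) => /scaler_e_inj /eqP.
by rewrite addr_eq0 => /eqP.
Qed.

(** Both operators being the normal cone of [e], every [z] is a fixed point and
    must be sent by [S] to the only zero [e]. *)
Lemma encoding_S_coeffs : s0 = 0 /\ s2 = 1 - s1.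
Proof.
have Se z : s0 *: z + s1 *: e + s2 *: e = e.
  have /zero_point[] : op_add (point_maxmon e) (point_maxmon e)
      (S (point_maxmon e) (point_maxmon e) z) 0; last by rewrite S_point.
  apply/enc; exists z; split=> //.
  by rewrite T_point encoding_T_input_coeff encoding_T_opposite_coeffs
    scale1r scaleNr subrK.
have s12 : s1 + s2 = 1.
  by apply: scaler_e_inj; rewrite scalerDl scale1r -{3}(Se 0) scaler0 add0r.
split; last by rewrite -s12 addrAC subrr add0r.
apply: scaler_e_inj; have := Se e; rewrite -!scalerDl -addrA s12.
by rewrite -{2}(scale1r e) => /scaler_e_inj H; rewrite -[s0](addrK 1) H subrr.
Qed.

(** The constant operators [u] and [- u] have every [x] as a zero; at the
    corresponding fixed point both resolvents must return [x]. *)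
Lemma encoding_inputs (x u : 'rV[R]_d) : exists z,
  a *: z = x + alpha *: u /\ b *: z = (1 - c) *: x - beta *: u.
Proof.
have [_ /(_ (zero_const u x))] := enc (const_maxmon u) (const_maxmon (- u)) x.
move=> [z [Tz Sz]]; exists z; move: Tz Sz.
have /= := shape (const_maxmon u) (const_maxmon (- u)) z.
rewrite encoding_T_input_coeff encoding_T_opposite_coeffs.
have [-> ->] := encoding_S_coeffs.
set x1 := resolvent alpha _ _; set x2 := resolvent beta _ _.
move=> [-> ->]; rewrite scale1r scale0r add0r => Tz.
have x21 : x2 = x1.
  apply/subr0_eq; have /eqP := Tz.
  rewrite -addrA -subr_eq0 addrAC subrr add0r scaleNr addrC -scalerBr.
  by rewrite scaler_eq0 (negPf encoding_T_coeff_neq0) => /eqP.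
rewrite x21 -scalerDl addrC subrK scale1r => x1x.
have x1E : x1 = a *: z - alpha *: u by rewrite /x1 resolvent_const.
have x2E : x2 = b *: z + c *: x + beta *: u.
  by rewrite /x2 resolvent_const // x1x scalerN opprK.
split; first by rewrite -x1x x1E subrK.
by apply/rowP => i; move: x21; rewrite x2E x1x => /rowP /(_ i); rewrite !mxE; lra.
Qed.

Lemma encoding_input_coeffs :
  [/\ a != 0, b = - (beta / alpha) * a & c = 1 + beta / alpha].
Proof.
have an : alpha != 0 by rewrite gt_eqF.
(* The case [u = 0] relates [b], [a] and [c]. *)
have [z [az bz]] := encoding_inputs e 0; rewrite !scaler0 addr0 subr0 in az bz.
have a0 : a != 0.
  apply/eqP => a0; have /scaler_e_inj /eqP : 0 *: e = 1 *: e.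
    by rewrite scale1r -az a0 !scale0r.
  by rewrite eq_sym oner_eq0.
have bac : b = a * (1 - c).
  apply: scaler_e_inj.
  by rewrite -[RHS]scalerA -bz -[in LHS]az !scalerA mulrC.
(* The case [x = 0] relates [b], [a] and the step sizes. *)
have [w [aw bw]] := encoding_inputs 0 e; rewrite !scaler0 !add0r in aw bw.
have ab : b * alpha = - a * beta.
  apply: scaler_e_inj.
  by rewrite -scalerA -aw mulNr scaleNr -scalerA -scalerN -bw !scalerA mulrC.
have bE : b = - (beta / alpha) * a.
  by apply: (mulIf an); rewrite ab; field.
split=> //; apply: (mulfI a0).
have -> : a * c = a - b by rewrite bac; ring.
by rewrite bE; ring.
Qed.

End Rigidity.

(** * The shape of a frugal evaluation *)

Section Programs.
Context {R : realType} {d : nat}.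
Variables alpha beta : R.
Implicit Types (Vs : seq (opmap R d)) (V F G : opmap R d) (p : seq (step R)).
Implicit Types (P : opmap R d -> Prop).

Lemma opmap_ext F G : (forall A B z, F A B z = G A B z) -> F = G.
Proof. by move=> FG; do 3!apply/funext => ?; apply: FG. Qed.

(** A symbolic execution: the available vectors are kept as functions of
    [(A, B, z)], so that coefficients found for them are uniform in the
    problem. *)
Definition sym_step Vs (s : step R) : opmap R d := fun A B z =>
  step_value alpha beta A B [seq V A B z | V <- Vs] s.

Definition sym_run Vs p := foldl (fun Ws s => rcons Ws (sym_step Ws s)) Vs p.

Definition opmap0 : opmap R d := fun _ _ _ => 0.

Lemma nth_map_eval Vs i A B z : nth 0 [seq V A B z | V <- Vs] i = nth opmap0 Vs i A B z.
Proof. by elim: Vs i => [|V Vs IH] [|i] //=. Qed.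

Lemma nth_run A B z p i :
  nth 0 (run alpha beta A B z p) i = nth opmap0 (sym_run [:: @Defs.map_id R d] p) i A B z.
Proof.
rewrite -nth_map_eval; congr nth.
rewrite /run -[[:: z]]/[seq V A B z | V <- [:: @Defs.map_id R d]].
elim: p [:: _] => [|s p IH] Vs //=.
by rewrite -IH map_rcons.
Qed.

Definition span_closed P :=
  [/\ P opmap0, forall F G, P F -> P G -> P (map_add F G) &
      forall c F, P F -> P (map_scale c F)].

Definition is_res (s : step R) := is_resA s || is_resB s.

Definition available P Vs := forall i, P (nth opmap0 Vs i).

Lemma available_rcons P Vs V : P opmap0 -> available P Vs -> P V ->
  available P (rcons Vs V).
Proof. by move=> P0 PVs PV i; rewrite nth_rcons; case: ifP => // _; case: ifP. Qed.

(** Only the two resolvent steps can leave a family of maps that is closed under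
    linear combinations. *)
Lemma linear_steps P Vs p : span_closed P -> ~~ has is_res p ->
  available P Vs -> available P (sym_run Vs p).
Proof.
move=> [P0 PD PZ]; elim: p Vs => [|s p IH] Vs //=.
rewrite negb_or => /andP[s_lin p_lin] PVs; apply: IH => //.
apply: available_rcons => //; case: s s_lin => // [c i|i j] _.
  suff -> : sym_step Vs (ScaleStep c i) = map_scale c (nth opmap0 Vs i) by apply: PZ.
  by apply: opmap_ext => A B z; rewrite /sym_step /= nth_map_eval.
suff -> : sym_step Vs (AddStep R i j) =
          map_add (nth opmap0 Vs i) (nth opmap0 Vs j) by apply: PD.
by apply: opmap_ext => A B z; rewrite /sym_step /= !nth_map_eval.
Qed.

Definition step_resolvent (s : step R) : opmap R d :=
  if is_resA s then map_res1 alpha else map_res2 beta.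

Lemma sym_step_resolvent Vs s : is_res s ->
  exists i, sym_step Vs s = Defs.map_comp (step_resolvent s) (nth opmap0 Vs i).
Proof.
case: s => // i _; exists i.
  by apply: opmap_ext => A B z; rewrite /sym_step /= nth_map_eval.
by apply: opmap_ext => A B z; rewrite /sym_step /= nth_map_eval.
Qed.

(** The uniform linear combinations of the input and of two given maps. *)
Definition span3 X1 X2 (V : opmap R d) := exists k0 k1 k2 : R, forall A B z,
  V A B z = k0 *: z + k1 *: X1 A B z + k2 *: X2 A B z.

Lemma span3_closed X1 X2 : span_closed (span3 X1 X2).
Proof.
split=> [|F G [f0 [f1 [f2 EF]]] [g0 [g1 [g2 EG]]]|c F [f0 [f1 [f2 EF]]]].
- by exists 0, 0, 0 => A B z; rewrite !scale0r !addr0.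
- exists (f0 + g0), (f1 + g1), (f2 + g2) => A B z.
  by rewrite /map_add EF EG; apply/rowP => i; rewrite !mxE; ring.
- exists (c * f0), (c * f1), (c * f2) => A B z.
  by rewrite /map_scale EF; apply/rowP => i; rewrite !mxE; ring.
Qed.

Lemma split_resolvents p : count (@is_resA R) p = 1%N -> count (@is_resB R) p = 1%N ->
  exists p1 s1 p2 s2 p3, [/\ p = p1 ++ s1 :: p2 ++ s2 :: p3,
    [/\ ~~ has is_res p1, ~~ has is_res p2 & ~~ has is_res p3],
    is_res s1, is_res s2 & is_resA s2 = ~~ is_resA s1].
Proof.
move=> cA cB.
have sumAB q : count is_res q = (count (@is_resA R) q + count (@is_resB R) q)%N.
  by elim: q => //= s q ->; rewrite addnACA; case: s.
have has1 q : (0 < count is_res q)%N -> exists q1 s q2,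
    [/\ q = q1 ++ s :: q2, ~~ has is_res q1 & is_res s].
  rewrite -has_count => /split_find[s q1 q2 rs nq1].
  by exists q1, s, q2; rewrite cat_rcons.
have [|p1 [s1 [q [Ep np1 rs1]]]] := has1 p; first by rewrite sumAB cA cB.
have cp1 : count is_res p1 = 0%N by apply/eqP; rewrite -leqn0 leqNgt -has_count.
have cq : count is_res q = 1%N.
  by move: (sumAB p); rewrite cA cB {1}Ep count_cat /= cp1 rs1 => -[].
have [|p2 [s2 [p3 [Eq np2 rs2]]]] := has1 q; first by rewrite cq.
have cp2 : count is_res p2 = 0%N by apply/eqP; rewrite -leqn0 leqNgt -has_count.
have cp3 : count is_res p3 = 0%N.
  by move: cq; rewrite Eq count_cat /= cp2 rs2 => -[].
exists p1, s1, p2, s2, p3; split=> //; first by rewrite Ep Eq.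
  by split=> //; rewrite has_count cp3.
move: cA cB; rewrite Ep Eq !count_cat /= !count_cat /=.
move: (sumAB p1) (sumAB p2) (sumAB p3); rewrite cp1 cp2 cp3.
move=> /esym/eqP; rewrite addn_eq0 => /andP[/eqP-> /eqP->].
move=> /esym/eqP; rewrite addn_eq0 => /andP[/eqP-> /eqP->].
move=> /esym/eqP; rewrite addn_eq0 => /andP[/eqP-> /eqP->].
by case: (s1) rs1 => // i1 _; case: (s2) rs2.
Qed.

(** Cut the program at its two resolvent steps.  Before the first one all vectors
    are multiples of [z], between them combinations of [z] and [x1], and after
    the second one combinations of [z], [x1] and [x2]. *)
Lemma program_shape p (i j : nat) :
  count (@is_resA R) p = 1%N -> count (@is_resB R) p = 1%N ->
  exists (s1 s2 : step R) (a b c t0 t1 t2 k0 k1 k2 : R),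
  [/\ is_res s1, is_res s2, is_resA s2 = ~~ is_resA s1 &
  forall A B z,
  let x1 := step_resolvent s1 A B (a *: z) in
  let x2 := step_resolvent s2 A B (b *: z + c *: x1) in
  nth 0 (run alpha beta A B z p) i = t0 *: z + t1 *: x1 + t2 *: x2 /\
  nth 0 (run alpha beta A B z p) j = k0 *: z + k1 *: x1 + k2 *: x2].
Proof.
move=> cA cB.
have [p1 [s1 [p2 [s2 [p3 [-> [l1 l2 l3] r1 r2 r12]]]]]] := split_resolvents cA cB.
pose W1 := sym_run [:: @Defs.map_id R d] p1.
have h1 : available (span3 opmap0 opmap0) W1.
  apply: linear_steps => //; first exact: span3_closed.
  case=> [|n] /=; first by exists 1, 0, 0 => A B z; rewrite scale1r !scale0r !addr0.
  by rewrite nth_nil; case: (span3_closed opmap0 opmap0).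
have [i1 E1] := sym_step_resolvent W1 r1.
have [a [a1 [a2 Ea]]] := h1 i1.
pose X1 : opmap R d := fun A B z => step_resolvent s1 A B (a *: z).
have {}E1 : sym_step W1 s1 = X1.
  by rewrite E1; apply: opmap_ext => A B z; rewrite /Defs.map_comp Ea !scaler0 !addr0.
pose W2 := sym_run (rcons W1 (sym_step W1 s1)) p2.
have h2 : available (span3 X1 opmap0) W2.
  apply: linear_steps => //; first exact: span3_closed.
  apply: available_rcons; first by case: (span3_closed X1 opmap0).
    move=> n; have [f0 [f1 [f2 Ef]]] := h1 n.
    by exists f0, 0, 0 => A B z; rewrite Ef !scaler0 scale0r.
  by exists 0, 1, 0 => A B z; rewrite E1 !scale0r scale1r addr0 add0r.
have [i2 E2] := sym_step_resolvent W2 r2.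
have [b [c [b2 Eb]]] := h2 i2.
pose X2 : opmap R d := fun A B z => step_resolvent s2 A B (b *: z + c *: X1 A B z).
have {}E2 : sym_step W2 s2 = X2.
  by rewrite E2; apply: opmap_ext => A B z; rewrite /Defs.map_comp Eb !scaler0 !addr0.
pose W3 := sym_run (rcons W2 (sym_step W2 s2)) p3.
have h3 : available (span3 X1 X2) W3.
  apply: linear_steps => //; first exact: span3_closed.
  apply: available_rcons; first by case: (span3_closed X1 X2).
    move=> n; have [f0 [f1 [f2 Ef]]] := h2 n.
    by exists f0, f1, 0 => A B z; rewrite Ef !scaler0 scale0r.
  by exists 0, 0, 1 => A B z; rewrite E2 !scale0r scale1r !add0r.
have [t0 [t1 [t2 Et]]] := h3 i; have [k0 [k1 [k2 Ek]]] := h3 j.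
exists s1, s2, a, b, c, t0, t1, t2, k0, k1, k2; split=> // A B z /=.
rewrite !nth_run /sym_run foldl_cat /= foldl_cat /=.
by rewrite -/(sym_run _ p1) -/W1 -/(sym_run _ p2) -/W2 -/(sym_run _ p3) -/W3 Et Ek.
Qed.

End Programs.

(** * Relaxed Douglas-Rachford splittings *)

Section DouglasRachford.
Context {R : realType} {d : nat}.
Implicit Types (T S F G : opmap R d) (P Q : opmap R d * opmap R d).

(** Each stage contains the previous one, since [F] is [1 *: F]. *)
Lemma res_stage_leq F i j : (i <= j)%N -> res_stage i F -> res_stage j F.
Proof.
move=> /subnK <-; elim: (j - i)%N => // n IH Fi.
right; exists 1 => //; exists F; first exact: IH.
by apply: opmap_ext => A B z; rewrite /map_scale scale1r.
Qed.

Lemma res_class_op2 F G (op : opmap R d -> opmap R d -> opmap R d) :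
  (forall i, res_stage i F -> res_stage i G ->
     res_stage i.+1 (op F G)) ->
  res_class F -> res_class G -> res_class (op F G).
Proof.
move=> opS [i _ Fi] [j _ Gj]; exists (maxn i j).+1 => //.
by apply: opS; [apply: res_stage_leq Fi; exact: leq_maxl
              | apply: res_stage_leq Gj; exact: leq_maxr].
Qed.

Lemma res_class_add F G : res_class F -> res_class G -> res_class (map_add F G).
Proof.
apply: (@res_class_op2 F G (@map_add R d)) => i Fi Gi.
by left; left; exists F => //; exists G.
Qed.

Lemma res_class_comp F G : res_class F -> res_class G -> res_class (Defs.map_comp F G).
Proof.
apply: (@res_class_op2 F G (@Defs.map_comp R d)) => i Fi Gi.
by left; right; exists F => //; exists G.
Qed.

Lemma res_class_scale c F : res_class F -> res_class (map_scale c F).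
Proof. by move=> [i _ Fi]; exists i.+1 => //; right; exists c => //; exists F. Qed.

Lemma res_class_id : res_class (@Defs.map_id R d).
Proof. by exists 0%N => //; left; left. Qed.

Lemma res_class_res1 a : 0 < a -> res_class (@map_res1 R d a).
Proof. by move=> a0; exists 0%N => //; left; right; exists a. Qed.

Lemma res_class_res2 b : 0 < b -> res_class (@map_res2 R d b).
Proof. by move=> b0; exists 0%N => //; right; exists b. Qed.

Lemma fixed_point_encoding_scale a P : a != 0 ->
  fixed_point_encoding P.1 P.2 ->
  fixed_point_encoding (Defs.scale_pair a P).1 (Defs.scale_pair a P).2.
Proof.
move=> a0 encP A B x; rewrite -encP /=; split=> -[z [Tz Sz]].
  by exists (a^-1 *: z); split=> //; rewrite -[in RHS]Tz scalerA mulVf // scale1r.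
by exists (a *: z); rewrite scalerA mulVf // scale1r Tz Sz.
Qed.

Lemma op_addC (A B : operator R d) x u : op_add A B x u -> op_add B A x u.
Proof. by move=> [v Av [w Bw <-]]; exists w => //; exists v => //; rewrite addrC. Qed.

Lemma fixed_point_encoding_swap P : fixed_point_encoding P.1 P.2 ->
  fixed_point_encoding (Defs.swap_pair P).1 (Defs.swap_pair P).2.
Proof. by move=> encP A B x /=; rewrite encP; split; apply: op_addC. Qed.

Definition dr_pair (alpha beta theta eta : R) : opmap R d * opmap R d :=
  let x1 (A B : maxmon R d) z := resolvent alpha A z in
  let x2 (A B : maxmon R d) z := resolvent beta B
     ((1 + beta / alpha) *: x1 A B z - (beta / alpha) *: z) in
  (fun A B z => z + theta *: (x2 A B z - x1 A B z),
   fun A B z => eta *: x1 A B z + (1 - eta) *: x2 A B z).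

(** Fixed points are the [z] at which both resolvents agree; they correspond to a
    zero [x] with [u \in A x] and [- u \in B x] through [z = x + alpha *: u]. *)
Lemma dr_encoding alpha beta theta eta : 0 < alpha -> 0 < beta -> theta != 0 ->
  fixed_point_encoding (dr_pair alpha beta theta eta).1
                       (dr_pair alpha beta theta eta).2.
Proof.
move=> alpha0 beta0 theta0 A B x /=.
have alphan : alpha != 0 by rewrite gt_eqF.
have betan : beta != 0 by rewrite gt_eqF.
split=> [[z []]|[u Au [v Bv uv0]]].
  have := resolvent_mem A z alpha0.
  set x1 := resolvent alpha A z; set w := _ - _ *: z.
  have := resolvent_mem B w beta0.
  set x2 := resolvent beta B w.
  move=> B2 A1 Tz Sz.
  have x21 : x2 = x1.
    apply/subr0_eq/eqP; move/eqP: Tz; rewrite -subr_eq0 addrAC subrr add0r.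
    by rewrite scaler_eq0 (negPf theta0).
  rewrite x21 in B2 Sz.
  have <- : x1 = x by rewrite -Sz -scalerDl addrC subrK scale1r.
  exists (alpha^-1 *: (z - x1)) => //; exists (beta^-1 *: (w - x1)) => //.
  by apply/rowP => i; rewrite /w !mxE; field; rewrite alphan betan.
have vE : v = - u by apply/eqP; rewrite -addr_eq0 addrC uv0.
exists (x + alpha *: u).
have -> : resolvent alpha A (x + alpha *: u) = x.
  by apply: resolvent_eq => //; case: (maxmonP A).
have -> : (1 + beta / alpha) *: x - (beta / alpha) *: (x + alpha *: u) =
    x + beta *: v.
  by rewrite vE; apply/rowP => i; rewrite !mxE; field.
have -> : resolvent beta B (x + beta *: v) = x.
  by apply: resolvent_eq => //; case: (maxmonP B).
by rewrite subrr scaler0 addr0 -scalerDl subrKC scale1r.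
Qed.

(** Address 1 holds the scaled input, 2 and 6 hold [x1] and [x2]; the values of
    [T] and [S] are found at addresses 11 and 14.  The two resolvent steps are
    parameters so that the same program serves for the swapped pair. *)
Definition dr_program (resP resQ : nat -> step R) (a rho theta eta : R) :=
  [:: ScaleStep a^-1 0;
      resP 1%N;
      ScaleStep (1 + rho) 2;
      ScaleStep (- rho) 1;
      AddStep R 3 4;
      resQ 5;
      ScaleStep (- 1) 2;
      AddStep R 6 7;
      ScaleStep theta 8;
      AddStep R 1 9;
      ScaleStep a 10;
      ScaleStep eta 2;
      ScaleStep (1 - eta) 6;
      AddStep R 12 13].

Lemma dr_frugal alpha beta theta eta a : 0 < alpha -> 0 < beta ->
  let P := Defs.scale_pair a (dr_pair alpha beta theta eta) in frugal P.1 P.2.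
Proof.
move=> alpha0 beta0; exists alpha, beta.
exists (dr_program (@ResAStep R) (@ResBStep R) a (beta / alpha) theta eta), 11%N, 14%N.
split=> // A B z; rewrite /= /dr_pair /=.
by rewrite !scaleNr scale1r.
Qed.

Lemma dr_frugal_swap alpha beta theta eta a : 0 < alpha -> 0 < beta ->
  let P := Defs.scale_pair a (Defs.swap_pair (dr_pair alpha beta theta eta)) in
  frugal P.1 P.2.
Proof.
move=> alpha0 beta0; exists beta, alpha.
exists (dr_program (@ResBStep R) (@ResAStep R) a (beta / alpha) theta eta), 11%N, 14%N.
split=> // A B z; rewrite /= /dr_pair /=.
by rewrite !scaleNr scale1r.
Qed.

Lemma dr_res_class (R1 R2 : opmap R d) (a rho theta eta : R) :
  res_class R1 -> res_class R2 ->
  let x1 A B z := R1 A B (a^-1 *: z) in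
  let x2 A B z := R2 A B ((1 + rho) *: x1 A B z - rho *: (a^-1 *: z)) in
  res_class (fun A B z => a *: (a^-1 *: z + theta *: (x2 A B z - x1 A B z))) /\
  res_class (fun A B z => eta *: x1 A B z + (1 - eta) *: x2 A B z).
Proof.
move=> r1 r2.
pose W := map_scale a^-1 (@Defs.map_id R d); pose X1 := Defs.map_comp R1 W.
pose X2 := Defs.map_comp R2 (map_add (map_scale (1 + rho) X1) (map_scale (- rho) W)).
have rW : res_class W by apply: res_class_scale; exact: res_class_id.
have rX1 : res_class X1 by apply: res_class_comp.
have rX2 : res_class X2.
  by apply: res_class_comp => //; apply: res_class_add; apply: res_class_scale.
have X2E A B z : X2 A B z = R2 A B ((1 + rho) *: R1 A B (a^-1 *: z) -
    rho *: (a^-1 *: z)) by rewrite -[in RHS]scaleNr.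
split.
  rewrite [X in res_class X](_ : _ = map_scale a (map_add W (map_scale theta
      (map_add X2 (map_scale (- 1) X1))))); last first.
    by apply: opmap_ext => A B z; rewrite /map_scale /map_add X2E scaleN1r.
  by do !(apply: res_class_scale || apply: res_class_add => //).
rewrite [X in res_class X](_ : _ =
    map_add (map_scale eta X1) (map_scale (1 - eta) X2)); last first.
  by apply: opmap_ext => A B z; rewrite /map_scale /map_add X2E.
by apply: res_class_add; apply: res_class_scale.
Qed.

Lemma dr_equivalent_frugal P alpha beta theta eta : 0 < alpha -> 0 < beta ->
  theta != 0 -> equivalent P (dr_pair alpha beta theta eta) ->
  frugal_splitting_without_lifting P.1 P.2.
Proof.
move=> alpha0 beta0 theta0 [a a0 [] ->]; split.
- have [rT rS] := dr_res_class a (beta / alpha) theta eta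
    (res_class_res1 alpha0) (res_class_res2 beta0).
  by split=> //; apply: fixed_point_encoding_scale => //; apply: dr_encoding.
- exact: dr_frugal.
- have [rT rS] := dr_res_class a (beta / alpha) theta eta
    (res_class_res2 alpha0) (res_class_res1 beta0).
  split=> //; apply: fixed_point_encoding_scale => //.
  by apply: fixed_point_encoding_swap; apply: dr_encoding.
- exact: dr_frugal_swap.
Qed.

(** Since the first resolvent sees [a *: z], the pair is a rescaled
    Douglas-Rachford pair, the factor outside being [a^-1]. *)
Lemma encoding_dr P (alpha beta a b c t0 t1 t2 s0 s1 s2 : R) : (1 <= d)%N ->
  0 < alpha -> 0 < beta -> fixed_point_encoding P.1 P.2 ->
  (forall (A B : maxmon R d) z,
    let x1 := resolvent alpha A (a *: z) in
    let x2 := resolvent beta B (b *: z + c *: x1) in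
    P.1 A B z = t0 *: z + t1 *: x1 + t2 *: x2 /\
    P.2 A B z = s0 *: z + s1 *: x1 + s2 *: x2) ->
  exists k theta eta, [/\ k != 0, theta != 0 &
    P = Defs.scale_pair k (dr_pair alpha beta theta eta)].
Proof.
move=> hd alpha0 beta0 encP shape.
have [a0 bE cE] := encoding_input_coeffs hd alpha0 beta0 encP shape.
have [s00 s2E] := encoding_S_coeffs hd alpha0 beta0 encP shape.
have t2n := encoding_T_coeff_neq0 hd alpha0 beta0 encP shape.
exists a^-1, (a * t2), s1; split; rewrite ?invr_eq0 ?mulf_neq0 //.
have inner (A : maxmon R d) (z : 'rV[R]_d) : b *: z + c *: resolvent alpha A (a *: z) =
    (1 + beta / alpha) *: resolvent alpha A (a *: z) - (beta / alpha) *: (a *: z).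
  by rewrite cE bE addrC mulNr scaleNr scalerA.
rewrite [LHS]surjective_pairing; congr pair; apply: opmap_ext => A B z.
  rewrite (shape A B z).1 /= invrK inner.
  rewrite (encoding_T_input_coeff hd alpha0 beta0 encP shape).
  rewrite (encoding_T_opposite_coeffs hd alpha0 beta0 encP shape).
  by apply/rowP => i; rewrite !mxE; field.
by rewrite (shape A B z).2 /= invrK inner s00 s2E scale0r add0r.
Qed.

Lemma frugal_equivalent_dr T S : (1 <= d)%N ->
  fixed_point_encoding T S -> frugal T S ->
  exists alpha beta theta eta, [/\ 0 < alpha, 0 < beta, theta != 0 &
    equivalent (T, S) (dr_pair alpha beta theta eta)].
Proof.
move=> hd encTS [alpha [beta [p [i [j [alpha0 beta0 _ [cA cB] out]]]]]].
have [s1 [s2 [a [b [c [t0 [t1 [t2 [k0 [k1 [k2 [r1 r2 r12 shape]]]]]]]]]]]] :=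
  @program_shape R d alpha beta p i j cA cB.
have [fstA|fstB] := boolP (is_resA s1).
  have [//|//|//|A B z|k [theta [eta [kn thetan E]]]] :=
    @encoding_dr (T, S) alpha beta a b c t0 t1 t2 k0 k1 k2 hd.
    rewrite /=; have [-> ->] := out A B z; have := shape A B z.
    by rewrite /step_resolvent r12 fstA.
  by exists alpha, beta, theta, eta; split=> //; exists k => //; left.
have [//|//||A B z|k [theta [eta [kn thetan E]]]] :=
    @encoding_dr (Defs.swap_pair (T, S)) beta alpha a b c t0 t1 t2 k0 k1 k2 hd.
- exact: fixed_point_encoding_swap.
- rewrite /=; have [-> ->] := out B A z; have := shape B A z.
  by rewrite /step_resolvent r12 fstB (negPf fstB).
exists beta, alpha, theta, eta; split=> //; exists k => //; right.
by rewrite -[LHS]/(Defs.swap_pair (Defs.swap_pair (T, S))) E.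
Qed.

End DouglasRachford.

Theorem theorem1 (R : realType) (d : nat) (hd : (1 <= d)%N) (T S : opmap R d) :
  frugal_splitting_without_lifting T S <->
  exists That Shat : opmap R d,
    equivalent (T, S) (That, Shat) /\
    exists alpha beta theta eta : R,
      [/\ 0 < alpha, 0 < beta, theta != 0 &
        forall (A B : maxmon R d) (z : 'rV[R]_d),
          let x1 := resolvent alpha A z in
          let x2 := resolvent beta B
                      ((1 + beta / alpha) *: x1 - (beta / alpha) *: z) in
          That A B z = z + theta *: (x2 - x1) /\
          Shat A B z = eta *: x1 + (1 - eta) *: x2].
Proof.
split=> [[[encTS _ _] frTS]|].
  have [alpha [beta [theta [eta [alpha0 beta0 theta0 eqTS]]]]] :=
    frugal_equivalent_dr hd encTS frTS.
  exists (dr_pair alpha beta theta eta).1, (dr_pair alpha beta theta eta).2.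
  by split=> //; exists alpha, beta, theta, eta.
move=> [That [Shat [eqTS [alpha [beta [theta [eta [alpha0 beta0 theta0 E]]]]]]]].
have EhatP : (That, Shat) = dr_pair alpha beta theta eta.
  by congr pair; apply: opmap_ext => A B z; case: (E A B z).
rewrite EhatP in eqTS.
exact: (dr_equivalent_frugal alpha0 beta0 theta0 eqTS).
Qed.
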